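(* Let $C \ge 10$ be a real number. Let $n, A, B, a_1, a_2, b_1, b_2$ be positive integers such that $$n = AB = (A + a_1)(B - b_1) = (A + a_2)(B - b_2)$$ with $1 \le a_1 < a_2 \le C$ and $1 \le b_1 < b_2 \le C$. Then $$A \le \tfrac{1}{4} C^3 - \tfrac{1}{2} C^2 + \tfrac{1}{4} C \quad\text{and}\quad B \le \tfrac{1}{4} C^3 - \tfrac{1}{2} C^2 + \tfrac{1}{4} C.$$ *)

(* Defs.v *)
From Stdlib Require Export Reals ZArith.

(* Main.v *)
Require Import Defs.
From Stdlib Require Import Reals ZArith Lia Lra.
Open Scope R_scope.

(** Put [D = a2 b1 - a1 b2].  Subtracting [A B] from the other two
    factorizations gives two linear equations in [A] and [B] with determinant
    [D], so that [D B = b1 b2 (a2 - a1)]; in particular [D >= 1].  The numbers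
    [a2 b1] and [b2 (a2 - a1)] have sum [a2 b2 + D] and product [a2 D B], so
    AM-GM yields [4 a2 D B <= (a2 b2 + D)^2]: roughly [B <= a2 b2^2 / (4 D)].

    Let [N] bound [a2] and [b2]; the target is [4 B <= N (N - 1)^2], that is
    [N^3 - 2 N^2 + N].  When [D >= 2] half of [N^3] is already enough.  When
    [D = 1] the AM-GM bound suffices unless [(a2, b2)] is one of the few pairs
    closest to [(N, N)].  For each of those, [a2 b1 - a1 b2 = 1] is a congruence
    that determines [a1] and [b1]; the pair [(N - 2, N)] attains equality.

    The bound on [A] is the bound on [B] for another reading of the same data.
    With [A' = A + a2] and [B' = B - b2] as the base point, and the two
    coordinates exchanged, the increments become [b2 - b1 < b2] and
    [a2 - a1 < a2], and [A + a2] is in the place of [B].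

    Finally [N = max 10 (max a2 b2)] satisfies [N <= C], and [x (x - 1)^2]
    increases for [x >= 1]. *)

(** Cramer's rule for [a_i B - b_i A = a_i b_i], solved for [B]. *)
Lemma determinant_mul_B (A B a1 a2 b1 b2 : Z) :
  (A * B = (A + a1) * (B - b1))%Z ->
  (A * B = (A + a2) * (B - b2))%Z ->
  ((a2 * b1 - a1 * b2) * B = b1 * b2 * (a2 - a1))%Z.
Proof.
  intros h1 h2.
  assert (e1 : (a1 * B - b1 * A = a1 * b1)%Z) by lia.
  assert (e2 : (a2 * B - b2 * A = a2 * b2)%Z) by lia.
  transitivity (b1 * (a2 * B - b2 * A) - b2 * (a1 * B - b1 * A))%Z; [ring |].
  rewrite e1, e2; ring.
Qed.

(** AM-GM for [a2 b1] and [b2 (a2 - a1)]. *)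
Lemma determinant_am_gm (B a1 a2 b1 b2 D : Z) :
  (D = a2 * b1 - a1 * b2)%Z ->
  (D * B = b1 * b2 * (a2 - a1))%Z ->
  (4 * a2 * (D * B) <= (a2 * b2 + D) ^ 2)%Z.
Proof.
  intros hD hB.
  pose proof (Z.square_nonneg (a2 * b1 - b2 * (a2 - a1))) as sq.
  rewrite hB, hD; lia.
Qed.

Lemma B_le_of_determinant_ge_2 (B a2 b2 D N : Z) :
  (10 <= N)%Z -> (0 < a2 <= N)%Z -> (0 < b2 <= N)%Z ->
  (2 <= D <= a2 * b2)%Z ->
  (4 * a2 * (D * B) <= (a2 * b2 + D) ^ 2)%Z ->
  (4 * B <= N * (N - 1) ^ 2)%Z.
Proof.
  intros hN ha hb hD amgm.
  (* Replacing D^2 by D a2 b2 makes the AM-GM bound divisible by a2. *)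
  assert (h1 : (D * (4 * B - 3 * b2) <= a2 * b2 ^ 2)%Z).
  { assert (D * D <= D * (a2 * b2))%Z by nia.
    apply (Zmult_le_reg_r _ _ a2); lia. }
  assert (h2 : (2 * (4 * B - 3 * b2) <= a2 * b2 ^ 2)%Z).
  { destruct (Z.le_gt_cases 0 (4 * B - 3 * b2)); nia. }
  assert (h3 : (a2 * b2 ^ 2 <= N * N ^ 2)%Z).
  { apply Z.mul_le_mono_nonneg; try lia; nia. }
  nia.
Qed.

Lemma B_le_of_determinant_eq_1 (B a1 a2 b1 b2 N : Z) :
  (10 <= N)%Z -> (1 <= a1 < a2)%Z -> (1 <= b1 < b2)%Z ->
  (a2 <= N)%Z -> (b2 <= N)%Z ->
  (a2 * b1 - a1 * b2 = 1)%Z ->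
  (B = b1 * b2 * (a2 - a1))%Z ->
  (4 * a2 * B <= (a2 * b2 + 1) ^ 2)%Z ->
  (4 * B <= N * (N - 1) ^ 2)%Z.
Proof.
  intros hN ha hb haN hbN hD hB amgm.
  assert (h1 : (4 * B <= a2 * b2 ^ 2 + 2 * b2 + 1)%Z).
  { apply (Zmult_le_reg_r _ _ a2); lia. }
  assert (region : forall u v : Z, (a2 <= u)%Z -> (b2 <= v)%Z ->
    (a2 * b2 ^ 2 + 2 * b2 + 1 <= u * v ^ 2 + 2 * v + 1)%Z).
  { intros u v hu hv.
    assert (a2 * b2 ^ 2 <= u * v ^ 2)%Z
      by (apply Z.mul_le_mono_nonneg; try lia; nia).
    lia. }
  (* Pairs outside these three boxes are (N, N), (N - 1, N), (N - 2, N) and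
     (N, N - 1). *)
  assert (cases : (a2 <= N - 3 \/ b2 <= N - 2 \/ (a2 <= N - 1 /\ b2 <= N - 1)
      \/ (a2 = N /\ b2 = N) \/ (a2 = N - 1 /\ b2 = N) \/ (a2 = N - 2 /\ b2 = N)
      \/ (a2 = N /\ b2 = N - 1))%Z) by lia.
  destruct cases as [c | [c | [[c c'] | [[c c'] | [[c c'] | [[c c'] | [c c']]]]]]].
  - specialize (region (N - 3)%Z N c hbN); nia.
  - specialize (region N (N - 2)%Z haN c); nia.
  - specialize (region (N - 1)%Z (N - 1)%Z c c'); nia.
  - (* N would divide 1. *)
    exfalso; subst a2 b2.
    assert (N * (b1 - a1) = 1)%Z by lia.
    destruct (Z.le_gt_cases (b1 - a1) 0); nia.
  - (* N - 1 divides a1 + 1, and 1 < a1 + 1 <= N - 1. *)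
    subst a2 b2.
    assert (k : ((N - 1) * (b1 - a1) = a1 + 1)%Z) by lia.
    assert (b1 - a1 = 1)%Z by nia.
    assert (a1 = N - 2)%Z by nia.
    assert (b1 = N - 1)%Z by lia.
    subst a1 b1. nia.
  - (* N - 2 divides 2 a1 + 1 < 2 (N - 2); equality holds in the conclusion. *)
    subst a2 b2.
    assert (k : ((N - 2) * (b1 - a1) = 2 * a1 + 1)%Z) by lia.
    assert (b1 - a1 = 1)%Z by nia.
    assert (eN : (N = 2 * a1 + 3)%Z) by nia.
    assert (b1 = a1 + 1)%Z by lia.
    subst N b1. nia.
  - (* N - 1 divides b1 - 1, and 0 <= b1 - 1 < N - 1. *)
    subst a2 b2.
    assert (k : ((N - 1) * (a1 - b1) = b1 - 1)%Z) by lia.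
    assert (a1 - b1 = 0)%Z by nia.
    assert (b1 = 1)%Z by nia.
    assert (a1 = 1)%Z by lia.
    subst a1 b1. nia.
Qed.

Lemma B_le_of_three_factorizations (A B a1 a2 b1 b2 N : Z) :
  (10 <= N)%Z -> (0 < B)%Z ->
  (1 <= a1 < a2)%Z -> (1 <= b1 < b2)%Z ->
  (a2 <= N)%Z -> (b2 <= N)%Z ->
  (A * B = (A + a1) * (B - b1))%Z ->
  (A * B = (A + a2) * (B - b2))%Z ->
  (4 * B <= N * (N - 1) ^ 2)%Z.
Proof.
  intros hN hB ha hb haN hbN h1 h2.
  pose proof (determinant_mul_B A B a1 a2 b1 b2 h1 h2) as hDB.
  remember (a2 * b1 - a1 * b2)%Z as D eqn:hD.
  pose proof (determinant_am_gm B a1 a2 b1 b2 D hD hDB) as amgm.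
  assert (0 < D)%Z.
  { assert (0 < b1 * b2 * (a2 - a1))%Z by (repeat apply Z.mul_pos_pos; lia).
    apply (Z.mul_pos_cancel_r D B); lia. }
  destruct (Z.eq_dec D 1) as [D1 | D1].
  - rewrite D1 in *.
    apply (B_le_of_determinant_eq_1 B a1 a2 b1 b2 N); lia.
  - apply (B_le_of_determinant_ge_2 B a2 b2 D N); try lia; nia.
Qed.

(** The bound for [B] applied to the base point [(B - b2, A + a2)] bounds
    [A + a2], which exceeds [A]. *)
Lemma A_le_of_three_factorizations (A B a1 a2 b1 b2 N : Z) :
  (10 <= N)%Z -> (0 < A)%Z ->
  (1 <= a1 < a2)%Z -> (1 <= b1 < b2)%Z ->
  (a2 <= N)%Z -> (b2 <= N)%Z ->
  (A * B = (A + a1) * (B - b1))%Z ->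
  (A * B = (A + a2) * (B - b2))%Z ->
  (4 * A <= N * (N - 1) ^ 2)%Z.
Proof.
  intros hN hA ha hb haN hbN h1 h2.
  assert (4 * (A + a2) <= N * (N - 1) ^ 2)%Z; [| lia].
  apply (B_le_of_three_factorizations
           (B - b2) (A + a2) (b2 - b1) b2 (a2 - a1) a2 N); lia.
Qed.

Lemma IZR_le_cubic (x N : Z) (C : R) :
  (1 <= N)%Z -> IZR N <= C -> (4 * x <= N * (N - 1) ^ 2)%Z ->
  IZR x <= 1 / 4 * C ^ 3 - 1 / 2 * C ^ 2 + 1 / 4 * C.
Proof.
  intros hN hC hx.
  apply IZR_le in hN, hx.
  replace (N * (N - 1) ^ 2)%Z with (N * ((N - 1) * (N - 1)))%Z in hx by ring.
  rewrite !mult_IZR, minus_IZR in hx.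
  assert (sq : (IZR N - 1) * (IZR N - 1) <= (C - 1) * (C - 1))
    by (apply Rmult_le_compat; lra).
  assert (IZR N * ((IZR N - 1) * (IZR N - 1)) <= C * ((C - 1) * (C - 1)))
    by (apply Rmult_le_compat; try lra; apply Rle_0_sqr).
  lra.
Qed.

Theorem theorem2 (C : R) (n A B a1 a2 b1 b2 : Z)
  (hC : 10 <= C)
  (hn : (0 < n)%Z) (hA : (0 < A)%Z) (hB : (0 < B)%Z)
  (ha1 : (0 < a1)%Z) (ha2 : (0 < a2)%Z)
  (hb1 : (0 < b1)%Z) (hb2 : (0 < b2)%Z)
  (hAB : n = (A * B)%Z)
  (hAB1 : n = ((A + a1) * (B - b1))%Z)
  (hAB2 : n = ((A + a2) * (B - b2))%Z)
  (ha : (1 <= a1 < a2)%Z) (haC : IZR a2 <= C)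
  (hb : (1 <= b1 < b2)%Z) (hbC : IZR b2 <= C) :
  IZR A <= 1 / 4 * C ^ 3 - 1 / 2 * C ^ 2 + 1 / 4 * C /\
  IZR B <= 1 / 4 * C ^ 3 - 1 / 2 * C ^ 2 + 1 / 4 * C.
Proof.
  pose (N := Z.max 10 (Z.max a2 b2)).
  assert (hNC : IZR N <= C).
  { unfold N; destruct (Z.max_spec a2 b2) as [[_ ->] | [_ ->]];
      [destruct (Z.max_spec 10 b2) as [[_ ->] | [_ ->]]
      |destruct (Z.max_spec 10 a2) as [[_ ->] | [_ ->]]]; assumption. }
  rewrite hAB in hAB1, hAB2.
  split; apply (IZR_le_cubic _ N); try assumption; try lia.
  - apply (A_le_of_three_factorizations A B a1 a2 b1 b2); try assumption; lia.
  - apply (B_le_of_three_factorizations A B a1 a2 b1 b2); try assumption; lia.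
Qed.
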